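(* Let $(V,\nu)$ be a fuzzy antinormed linear space with respect to a t-conorm $\diamond$, and assume that (a) for every $x\in V$, if $\nu(x,t)<1$ for all $t>0$ then $x=\theta$; and (b) $a\diamond a=a$ for all $a\in[0,1]$. For $\alpha\in(0,1)$ let $\|x\|_\alpha^{*}=\inf\{t>0:\nu(x,t)\le 1-\alpha\}$ (an increasing family of norms on $V$). Then, for each $\alpha\in(0,1)$, every Cauchy sequence in $(V,\|\cdot\|_\alpha^{*})$ is a fuzzy $\alpha$-anti-Cauchy sequence in $(V,\nu)$.
   Context: $V$ is a linear space over $F$ ($F=\mathbb{R}$ or $\mathbb{C}$), and $\theta$ is its zero vector. A t-conorm is a map $\diamond:[0,1]\times[0,1]\to[0,1]$ that is commutative, associative, continuous, satisfies $a\diamond 0=a$ for all $a$, and satisfies $a\diamond b\le c\diamond d$ whenever $a\le c$, $b\le d$. A fuzzy antinorm on $V$ with respect to $\diamond$ is a function $\nu:V\times\mathbb{R}\to[0,1]$ such that for all $x,y\in V$: (i) $\nu(x,t)=1$ for all $t\le 0$; (ii) $\nu(x,t)=0$ for all $t>0$ if and only if $x=\theta$; (iii) $\nu(cx,t)=\nu(x,t/|c|)$ for all $t>0$ and $c\in F$, $c\ne 0$; (iv) $\nu(x+y,s+t)\le\nu(x,s)\diamond\nu(y,t)$ for all $s,t\in\mathbb{R}$; (v) $\lim_{t\to\infty}\nu(x,t)=0$. The pair $(V,\nu)$ is then called a fuzzy antinormed linear space with respect to $\diamond$. For $\alpha\in(0,1)$, a sequence $(x_n)$ in $V$ is fuzzy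 $\alpha$-anti-Cauchy if $\lim_{n\to\infty}\nu(x_n-x_{n+p},t)\le 1-\alpha$ for all $t>0$ and all $p=1,2,3,\dots$.
   Formalization: In the definition of fuzzy α-anti-Cauchy, the limit of ν(x_n − x_{n+p}, t) is taken as an upper limit (limsup), because the limit itself need not exist for a Cauchy sequence in the α-norm; where it exists, the bound is the stated one. *)

(* Defs.v *)
From HB Require Import structures.
From mathcomp Require Import all_boot all_order all_algebra complex.
From mathcomp Require Import all_classical all_reals all_analysis.
From mathcomp Require Import ring lra.

Set Implicit Arguments.
Unset Strict Implicit.
Unset Printing Implicit Defensive.

Import Order.TTheory GRing.Theory Num.Theory.
Import numFieldNormedType.Exports.

Local Open Scope classical_set_scope.
Local Open Scope ring_scope.

Inductive scalars := RealScalars | ComplexScalars.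

Definition scalar_field (R : realType) (F : scalars) : numFieldType :=
  match F with
  | RealScalars => R
  | ComplexScalars => R[i]
  end.

(* The MathComp norm of [R[i]] takes its values in [R[i]]; the modulus below is
   the real-valued one. *)
Definition modulus (R : realType) (F : scalars) : scalar_field R F -> R :=
  match F return scalar_field R F -> R with
  | RealScalars => fun c : R => `|c|
  | ComplexScalars => fun c : R[i] => Normc.normc c
  end.

(* A t-conorm is represented by a total function on [R], of which only the
   restriction to the unit square is constrained. *)
Record is_tconorm (R : realType) (conorm : R -> R -> R) : Prop := IsTconorm {
  tconorm_itv : forall a b, 0 <= a <= 1 -> 0 <= b <= 1 ->
    0 <= conorm a b <= 1;
  tconormC : forall a b, 0 <= a <= 1 -> 0 <= b <= 1 ->
    conorm a b = conorm b a;
  tconormA : forall a b c, 0 <= a <= 1 -> 0 <= b <= 1 -> 0 <= c <= 1 ->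
    conorm a (conorm b c) = conorm (conorm a b) c;
  tconorm_continuous :
    {within `[0, 1]%classic `*` `[0, 1]%classic,
      continuous (fun p : R * R => conorm p.1 p.2)};
  tconorm0 : forall a, 0 <= a <= 1 -> conorm a 0 = a;
  tconorm_le : forall a b c d,
    0 <= a <= 1 -> 0 <= b <= 1 -> 0 <= c <= 1 -> 0 <= d <= 1 ->
    a <= c -> b <= d -> conorm a b <= conorm c d
}.

Record is_fuzzy_antinorm (R : realType) (F : scalars)
    (V : lmodType (scalar_field R F)) (conorm : R -> R -> R)
    (nu : V -> R -> R) : Prop := IsFuzzyAntinorm {
  antinorm_itv : forall x t, 0 <= nu x t <= 1;
  antinorm_le0 : forall x t, t <= 0 -> nu x t = 1;
  antinorm_eq0 : forall x, (forall t, 0 < t -> nu x t = 0) <-> x = 0;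
  antinormZ : forall x (c : scalar_field R F) t, c != 0 -> 0 < t ->
    nu (c *: x) t = nu x (t / modulus c);
  antinormD : forall x y s t, nu (x + y) (s + t) <= conorm (nu x s) (nu y t);
  antinorm_cvg0 : forall x, nu x t @[t --> +oo] --> (0 : R)
}.

Definition alpha_norm (R : realType) (F : scalars)
    (V : lmodType (scalar_field R F)) (nu : V -> R -> R) (alpha : R) (x : V)
    : R :=
  inf [set t | 0 < t /\ nu x t <= 1 - alpha].

Definition cauchy_for (R : realType) (V : zmodType) (N : V -> R)
    (x_ : nat -> V) : Prop :=
  forall e, 0 < e -> exists n0 : nat, forall m n : nat,
    (n0 <= m)%N -> (n0 <= n)%N -> N (x_ m - x_ n) < e.

(* The limit is an upper limit: for x_ Cauchy for [alpha_norm nu alpha] the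
   sequence below is eventually at most 1 - alpha, but it may oscillate between
   several values in [0, 1 - alpha] and then has no limit. *)
Definition fuzzy_anti_cauchy (R : realType) (V : zmodType)
    (nu : V -> R -> R) (alpha : R) (x_ : nat -> V) : Prop :=
  forall t, 0 < t -> forall p : nat, (0 < p)%N ->
    (limn_esup (fun n => (nu (x_ n - x_ (n + p)%N) t)%:E)
       <= (1 - alpha)%:E)%E.

Lemma modulus_gt0 (R : realType) (F : scalars) (c : scalar_field R F) :
  c != 0 -> 0 < modulus c.
Proof.
case: F c => [c c0|c c0] /=; first by rewrite normr_gt0.
rewrite lt_neqAle eq_sym; apply/andP; split.
  by apply/eqP => /Normc.eq0_normc c_eq0; rewrite c_eq0 eqxx in c0.
by case: c {c0} => a b; exact: sqrtr_ge0.
Qed.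

Lemma modulus0 (R : realType) (F : scalars) :
  modulus (0 : scalar_field R F) = 0.
Proof. by case: F; [exact: normr0 | exact: Normc.normc0]. Qed.

Section AlphaNorm.
Context (R : realType) (F : scalars) (V : lmodType (scalar_field R F)).
Context (conorm : R -> R -> R) (nu : V -> R -> R).
Context (conormP : is_tconorm conorm) (nuP : is_fuzzy_antinorm conorm nu).

Let S alpha x := [set t | 0 < t /\ nu x t <= 1 - alpha].

Lemma antinorm_ninc x s t : s <= t -> nu x t <= nu x s.
Proof.
rewrite le_eqVlt => /predU1P[->//|st].
have := antinormD nuP x 0 s (t - s).
rewrite addr0 subrKC (antinorm_eq0 nuP 0).2 ?subr_gt0//.
by rewrite (tconorm0 conormP)//; exact: (antinorm_itv nuP).
Qed.

Lemma alpha_set_inf alpha x : alpha < 1 -> has_inf (S alpha x).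
Proof.
move=> a1; split; last by exists 0 => t [/ltW].
have /cvgrPdist_lt/(_ (1 - alpha)) := antinorm_cvg0 nuP x.
rewrite subr_gt0 => /(_ a1)[M [_ MP]].
exists (Num.max M 0 + 1); split; first by rewrite ltr_wpDl// le_max lexx orbT.
have := MP (Num.max M 0 + 1).
rewrite /= sub0r normrN => /(_ _)/ltW.
have /andP[n0 _] := antinorm_itv nuP x (Num.max M 0 + 1).
by rewrite ger0_norm//; apply; rewrite ltr_pwDr// le_max lexx.
Qed.

Lemma alpha_norm_lt alpha x e : alpha < 1 ->
  alpha_norm nu alpha x < e -> nu x e <= 1 - alpha.
Proof.
move=> a1 /inf_lt[]; first by have [] := alpha_set_inf x a1.
by move=> t [_ xt] /ltW /(antinorm_ninc x) /le_trans; apply.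
Qed.

Lemma alpha_norm_ge0 alpha x : alpha < 1 -> 0 <= alpha_norm nu alpha x.
Proof.
move=> a1; apply: lb_le_inf; first by have [] := alpha_set_inf x a1.
by move=> t [/ltW].
Qed.

Lemma alpha_norm_le alpha x t : alpha < 1 -> 0 < t -> nu x t <= 1 - alpha ->
  alpha_norm nu alpha x <= t.
Proof.
by move=> a1 t0 xt; apply: ge_inf; first by have [] := alpha_set_inf x a1.
Qed.

Lemma alpha_norm0 alpha : alpha < 1 -> alpha_norm nu alpha 0 = 0.
Proof.
move=> a1; apply/eqP; rewrite eq_le alpha_norm_ge0// andbT.
apply/ler_addgt0Pr => e e0; rewrite add0r.
by apply: alpha_norm_le => //; rewrite (antinorm_eq0 nuP 0).2// subr_ge0 ltW.
Qed.

Lemma alpha_norm_eq0 alpha x :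
  (forall y, (forall t, 0 < t -> nu y t < 1) -> y = 0) ->
  0 < alpha < 1 -> alpha_norm nu alpha x = 0 -> x = 0.
Proof.
move=> nu1 /andP[a0 a1] x0; apply: nu1 => t t0.
by rewrite (@le_lt_trans _ _ (1 - alpha)) ?ltrBlDr ?ltrDl// alpha_norm_lt// x0.
Qed.

Lemma alpha_normZ alpha (c : scalar_field R F) x : alpha < 1 ->
  alpha_norm nu alpha (c *: x) = modulus c * alpha_norm nu alpha x.
Proof.
move=> a1; have [->|c0] := eqVneq c 0.
  by rewrite scale0r alpha_norm0// modulus0 mul0r.
have m0 := modulus_gt0 c0.
apply/eqP; rewrite eq_le; apply/andP; split.
- rewrite -ler_pdivrMl//; apply: lb_le_inf.
    by have [] := alpha_set_inf x a1.
  move=> t [t0 xt]; rewrite ler_pdivrMl//; apply: alpha_norm_le => //.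
    by rewrite mulr_gt0.
  by rewrite (antinormZ nuP)// ?mulr_gt0// mulrAC divff ?gt_eqF// mul1r.
- apply: lb_le_inf; first by have [] := alpha_set_inf (c *: x) a1.
  move=> t [t0 xt]; rewrite -ler_pdivlMl// mulrC.
  by apply: alpha_norm_le; rewrite ?divr_gt0// -(antinormZ nuP).
Qed.

Lemma alpha_normD alpha x y :
  (forall a, 0 <= a <= 1 -> conorm a a = a) -> 0 < alpha < 1 ->
  alpha_norm nu alpha (x + y) <= alpha_norm nu alpha x + alpha_norm nu alpha y.
Proof.
move=> idem /andP[a0 a1]; apply/ler_addgt0Pr => e e0.
have h z : nu z (alpha_norm nu alpha z + e / 2) <= 1 - alpha.
  by apply: alpha_norm_lt => //; rewrite ltrDl divr_gt0.
have -> : alpha_norm nu alpha x + alpha_norm nu alpha y + e =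
  (alpha_norm nu alpha x + e / 2) + (alpha_norm nu alpha y + e / 2) by field.
have itv : 0 <= 1 - alpha <= 1 by lra.
apply: alpha_norm_le => //.
  by rewrite addr_gt0// ltr_wpDl ?alpha_norm_ge0// divr_gt0.
apply: le_trans (antinormD nuP _ _ _ _) _; rewrite -(idem _ itv).
by apply: (tconorm_le conormP) => //; exact: (antinorm_itv nuP).
Qed.

Lemma alpha_norm_increasing alpha beta x : alpha <= beta -> beta < 1 ->
  alpha_norm nu alpha x <= alpha_norm nu beta x.
Proof.
move=> ab b1; apply: lb_le_inf; first by have [] := alpha_set_inf x b1.
move=> t [t0 xt]; apply: alpha_norm_le => //; first exact: le_lt_trans b1.
by rewrite (le_trans xt)// lerB.
Qed.

End AlphaNorm.

(* Main.v *)
Require Import Defs.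
From mathcomp Require Import all_boot all_order all_algebra.
From mathcomp Require Import all_classical all_reals all_analysis.

Import Order.TTheory GRing.Theory Num.Theory.
Local Open Scope ring_scope.

(** A norm [alpha_norm nu alpha x < t] means that some [s < t] already satisfies
    [nu x s <= 1 - alpha]; since [nu x] is nonincreasing, also
    [nu x t <= 1 - alpha] ([alpha_norm_lt]). Fix [t > 0] and [p]. The Cauchy
    property with [e := t] makes the norm of [x_ n - x_ (n + p)] smaller than [t]
    for all large [n], so [nu (x_ n - x_ (n + p)) t <= 1 - alpha] eventually, and
    an upper limit never exceeds an eventual upper bound. *)

(** The set where [f <= l] holds belongs to [F], so the supremum of [f] over it
    is one of the values whose infimum defines the upper limit. *)
Lemma limf_esup_le_near (R : realType) (T : choiceType)
    (X : filteredType T) (F : set_system X) (f : X -> \bar R) (l : \bar R) :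
  (\forall x \near F, f x <= l)%E -> (limf_esup f F <= l)%E.
Proof.
move=> fl; rewrite limf_esupE.
apply: (@le_trans _ _ (ereal_sup (f @` [set x | f x <= l]%E)%classic)).
  by apply: ereal_inf_lbound; exists [set x | f x <= l]%E%classic.
by apply: ge_ereal_sup => _ [x xl <-].
Qed.

Theorem theorem4p8 (R : realType) (F : scalars)
    (V : lmodType (scalar_field R F))
    (conorm : R -> R -> R) (nu : V -> R -> R)
    (conormP : is_tconorm conorm)
    (nuP : is_fuzzy_antinorm conorm nu)
    (nu_lt1 : forall x : V, (forall t : R, 0 < t -> nu x t < 1) -> x = 0)
    (conorm_idem : forall a : R, 0 <= a <= 1 -> conorm a a = a)
    (alpha : R) (alpha01 : 0 < alpha < 1) (x_ : nat -> V) :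
  cauchy_for (alpha_norm nu alpha) x_ -> fuzzy_anti_cauchy nu alpha x_.
Proof.
move=> x_cauchy t t0 p _; have [n0 x_lt] := x_cauchy t t0.
have /andP[_ alpha1] := alpha01.
apply: limf_esup_le_near; exists n0 => //= n n0n.
rewrite lee_fin; apply: (alpha_norm_lt conormP nuP) => //.
by apply: x_lt => //; exact: leq_trans (leq_addr p n).
Qed.
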